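(* Let $N\ge1$ and let $x_1,\dots,x_N$ be nonzero real numbers. Let $d_k(1)$ be the coefficients of the polynomial $P(t)=t(1-t)\prod_{i=1}^N(1-x_it)$ expanded in powers of $u=1-t$, i.e. $P(t)=\sum_{k=0}^{N+2}d_k(1)u^k$. Then for $k=0,\dots,N+2$, $$d_k(1)=x_1\cdots x_N\left[\sigma_{N+1-k}\Bigl(\bigl(\tfrac{1-x_j}{x_j}\bigr)_{j=1,\dots,N}\Bigr)-\sigma_{N+2-k}\Bigl(\bigl(\tfrac{1-x_j}{x_j}\bigr)_{j=1,\dots,N}\Bigr)\right].$$ In particular $d_0(1)=0$.
   Context: $\sigma_l(y_1,\dots,y_k)$ is the $l$-th elementary symmetric polynomial in $k$ variables, with $\sigma_0=1$ (also for $k=0$) and $\sigma_l=0$ if $l<0$ or $l>k$. *)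

(* Defs.v *)
From mathcomp Require Import all_boot all_order all_algebra.
From mathcomp Require Import reals.
From mathcomp Require Import mpoly.

Set Implicit Arguments.
Unset Strict Implicit.
Unset Printing Implicit Defensive.

Import GRing.Theory.
Local Open Scope ring_scope.

(* Extends [mesym], which already vanishes for l > n, by 0 to l < 0. *)
Definition sigma (R : realType) (n : nat) (y : 'I_n -> R) (l : int) : R :=
  if l is Posz m then (mesym n R m).@[y] else 0.

Definition Ppoly (R : realType) (N : nat) (x : 'I_N -> R) : {poly R} :=
  'X * (1 - 'X) * \prod_(i < N) (1 - x i *: 'X).

(* Only d 0, ..., d (N + 2) matter. *)
Definition expansion_at1 (R : realType) (N : nat) (x : 'I_N -> R)
    (d : nat -> R) : Prop :=
  Ppoly x = \sum_(k < N.+3) d k *: (1 - 'X) ^+ k.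

Lemma expansion_at1_exists (R : realType) (N : nat) (x : 'I_N -> R) :
  exists d : nat -> R, expansion_at1 x d.
Proof.
have szM (p q : {poly R}) (a b : nat) : (size p <= a.+1)%N ->
    (size q <= b.+1)%N -> (size (p * q)%R <= (a + b).+1)%N.
  move=> pa qb; apply: leq_trans (size_polyMleq p q) _.
  by have := leq_add pa qb; rewrite addnS addSn; case: (_ + _)%N.
have szl (a : R) : (size (1 - a *: 'X)%R <= 2)%N.
  rewrite (leq_trans (size_polyD _ _)) // size_poly1 size_polyN geq_max /=.
  by rewrite (leq_trans (size_scale_leq _ _)) // size_polyX.
have szu : (size (1 - 'X : {poly R})%R <= 2)%N by rewrite -[X in _ - X]scale1r.
have szP : (size (Ppoly x) <= N.+3)%N.
  have szprod (s : seq 'I_N) :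
      (size (\prod_(i <- s) (1 - x i *: 'X))%R <= (size s).+1)%N.
    elim: s => [|i s IHs]; first by rewrite big_nil size_poly1.
    by rewrite big_cons; apply: (szM _ _ 1%N).
  rewrite /Ppoly -[N.+2]/(1 + 1 + N)%N.
  apply: (szM); first by apply: (szM); rewrite ?size_polyX.
  have := szprod (index_enum 'I_N).
  have -> // : size (index_enum 'I_N) = N.
  by rewrite -[RHS]card_ord cardT enumT.
pose q := Ppoly x \Po (1 - 'X).
have szq : (size q <= N.+3)%N.
  rewrite (leq_trans (size_comp_poly_leq _ _)) // ltnS.
  have h1 : ((size (1 - 'X : {poly R})%R).-1 <= 1)%N by case: size szu.
  rewrite (leq_trans (leq_mul (leqnn _) h1)) // muln1.
  by case: size szP.
exists (fun k => q`_k); rewrite /expansion_at1.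
have -> : Ppoly x = q \Po (1 - 'X).
  by rewrite /q -comp_polyA comp_polyB comp_polyX comp_polyC subKr comp_polyXr.
rewrite comp_polyE (big_ord_widen N.+3 (fun k => q`_k *: (1 - 'X) ^+ k)) //.
rewrite big_mkcond; apply: eq_bigr => i _.
by case: ltnP => // le_qi; rewrite nth_default ?scale0r.
Qed.

(* Main.v *)
Require Import Defs.
From mathcomp Require Import all_boot all_order all_algebra.
From mathcomp Require Import reals.
From mathcomp Require Import mpoly zify.

(** In the variable u = 1 - t one has 1 - x_i t = x_i (u + y_i) with
    y_i = (1 - x_i) / x_i, which is where x_i <> 0 enters.  So the polynomial
    becomes x_1 ... x_N (u - u^2) prod_i (u + y_i), whose last factor has
    elementary symmetric functions of the y_i as its coefficients
    ([coef_prod_XaddC]); multiplying by u - u^2 shifts them by one and by two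
    and subtracts ([coef_prod_XaddC_mulXn]).  The change of variable is
    composition with the involution [1 - 'X], applied both to the product form
    ([Ppoly_comp_subX]) and to the given expansion in powers of u, where it
    makes d_k an ordinary coefficient ([expansion_at1_coef]). *)

Import GRing.Theory.
Local Open Scope ring_scope.

(** Expanding the product chooses, for each i, either y_i or 'X; the choices
    that contribute to degree j take y_i on a set of n - j indices.  With the
    integer index this holds for every j: beyond the degree n the index is
    negative and both sides vanish. *)
Lemma coef_prod_XaddC (R : realType) (n : nat) (y : 'I_n -> R) (j : nat) :
  (\prod_(i < n) ('X + (y i)%:P))`_j = sigma y (n%:Z - j%:Z).
Proof.
have monomial (J : {set 'I_n}) :
    (\prod_i (if i \in J then (y i)%:P else 'X))`_j
    = if (#|J| + j == n)%N then \prod_(i in J) y i else 0.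
  have -> : \prod_i (if i \in J then (y i)%:P else 'X)
            = (\prod_(i in J) y i)%:P * 'X^(n - #|J|).
    rewrite big_if /= -rmorph_prod /=; congr (_ * _).
    rewrite prodr_const; congr ('X ^+ _).
    have := cardC (mem J); rewrite card_ord => /(congr1 (subn^~ #|J|)) <-.
    by rewrite addKn.
  have leJ : (#|J| <= n)%N by have := max_card (mem J); rewrite card_ord.
  rewrite coefCM coefXn mulr_natr mulrb.
  by rewrite -(eqn_add2l #|J|) subnKC.
under eq_bigr do rewrite addrC.
rewrite bigA_distr coef_sum.
under eq_bigr do rewrite monomial.
rewrite -big_mkcond /=.
case: (leqP j n) => [le_jn | lt_nj].
  rewrite subzn // /sigma /mesym raddf_sum /=.
  apply: eq_big => [J | J _].
    by rewrite -[RHS](eqn_add2r j) subnK.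
  by rewrite rmorph_prod; apply: eq_bigr => i _; rewrite /= mevalXU.
have -> : n%:Z - j%:Z = Negz (j - n).-1 by lia.
rewrite big1 // => J /eqP eqn.
by have := leq_addl #|J| j; rewrite eqn leqNgt lt_nj.
Qed.

Lemma sigma_gt (R : realType) (n : nat) (y : 'I_n -> R) (l : int) :
  n%:Z < l -> sigma y l = 0.
Proof.
case: l => [m|//]; rewrite ltz_nat => lt_nm.
by rewrite /sigma mesym_geqnE // meval0.
Qed.

(** The zero coefficients that the shift creates below degree m correspond to
    indices of sigma above n. *)
Lemma coef_prod_XaddC_mulXn (R : realType) (n : nat) (y : 'I_n -> R)
    (m j : nat) :
  (\prod_(i < n) ('X + (y i)%:P) * 'X^m)`_j = sigma y (n%:Z + m%:Z - j%:Z).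
Proof.
rewrite coefMXn; case: ltnP => [lt_jm | le_mj].
  by rewrite sigma_gt //; lia.
by rewrite coef_prod_XaddC; congr (sigma y _); lia.
Qed.

Lemma Ppoly_comp_subX (R : realType) (N : nat) (x : 'I_N -> R) :
  (forall i, x i != 0) ->
  Ppoly x \Po (1 - 'X) =
  (\prod_(i < N) x i) *:
    ((\prod_(i < N) ('X + ((1 - x i) / x i)%:P)) * 'X * (1 - 'X)).
Proof.
move=> x_neq0.
rewrite /Ppoly !comp_polyM comp_polyX comp_polyB comp_polyX comp_polyC subKr.
rewrite rmorph_prod /=.
have -> : \prod_(i < N) ((1 - x i *: 'X) \Po (1 - 'X)) =
    (\prod_(i < N) x i) *: \prod_(i < N) ('X + ((1 - x i) / x i)%:P).
  rewrite -scaler_prod; apply: eq_bigr => i _.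
  rewrite comp_polyB comp_polyC comp_polyZ comp_polyX.
  rewrite [RHS]scalerDr scale_polyC mulrC divfK // scalerBr alg_polyC polyCB.
  by rewrite opprB addrCA.
by rewrite -scalerAr; congr (_ *: _); rewrite mulrC [(1 - 'X) * 'X]mulrC mulrA.
Qed.

Lemma expansion_at1_coef (R : realType) (N : nat) (x : 'I_N -> R)
    (d : nat -> R) (k : nat) :
  expansion_at1 x d -> (k <= N.+2)%N -> d k = (Ppoly x \Po (1 - 'X))`_k.
Proof.
move=> -> le_kN; rewrite raddf_sum /=.
have -> : \sum_(i < N.+3) ((d i *: (1 - 'X) ^+ i) \Po (1 - 'X))
          = \poly_(i < N.+3) d i.
  rewrite poly_def; apply: eq_bigr => i _.
  by rewrite comp_polyZ rmorphXn /= comp_polyB comp_polyX comp_polyC subKr.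
by rewrite coef_poly ltnS le_kN.
Qed.

Theorem lemma4p6 (R : realType) (N : nat) (hN : (1 <= N)%N)
    (x : 'I_N -> R) (hx : forall i, x i != 0)
    (d : nat -> R) (hd : expansion_at1 x d) :
  let y : 'I_N -> R := fun j => (1 - x j) / x j in
  (forall k : nat, (k <= N.+2)%N ->
     d k = (\prod_(i < N) x i) *
           (sigma y (N%:Z + 1 - k%:Z) - sigma y (N%:Z + 2 - k%:Z)))
  /\ d 0%N = 0.
Proof.
move=> y.
have formula k : (k <= N.+2)%N ->
    d k = (\prod_(i < N) x i) *
          (sigma y (N%:Z + 1 - k%:Z) - sigma y (N%:Z + 2 - k%:Z)).
  move=> le_kN; rewrite (expansion_at1_coef _ _ _ _ _ hd le_kN).
  rewrite Ppoly_comp_subX // coefZ mulrBr mulr1 coefB -mulrA -expr2.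
  congr (_ * (_ - _)); last exact: coef_prod_XaddC_mulXn.
  (* 'X is 'X^1 by conversion. *)
  exact: (coef_prod_XaddC_mulXn _ _ y 1).
split=> //; rewrite formula // !subr0.
by rewrite !sigma_gt ?subr0 ?mulr0 //; lia.
Qed.
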